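(* Let $k\ge2$ and let $G$ be a digraph with vertex set the set of coordinate positions $\{1,\dots,2^k\}$, with induced weighted poset $P_{\tilde\pi}$ and associated map $\varphi_{\tilde\pi}$. If the extended Hamming code $\widetilde{\mathcal H}_k$ is a $2$-perfect $G$-code, then $\widetilde{\mathcal H}_k^{\varphi_{\tilde\pi}}=\{c^{\varphi_{\tilde\pi}}:c\in\widetilde{\mathcal H}_k\}$ is a covering $P_{\tilde\pi}$-code of covering radius $2$.
   Context: Binary vectors are identified with their supports. A weighted poset $P_\pi$ is a finite poset $(P,\preceq)$ with a function $\pi:P\to\{1,2,3,\dots\}$. Coordinates of $\mathbb{F}_2^{m}$, $m=|P|$, are labelled by $P$. $\langle x\rangle_P$ is the smallest order ideal (down-closed subset) containing the support of $x$; $w_{P_\pi}(x)=\sum_{i\in\langle x\rangle_P}\pi(i)$, $d_{P_\pi}(x,y)=w_{P_\pi}(x-y)$. A digraph $G$ is a finite directed graph without loops or multiple edges. Coordinates of $\mathbb{F}_2^n$, $n=|V(G)|$, are labelled by $V(G)$. $\langle x\rangle_G$ is the support of $x$ together with all vertices reachable by a directed path from it; $w_G(x)=|\langle x\rangle_G|$, $d_G(x,y)=w_G(x-y)$. For $*$ a weighted poset or a digraph, $S_*(x;r)=\{y:d_*(x,y)\le r\}$. A code $C$ is $r$-covering if the union of the spheres $S_*(c;r)$, $c\in C$, is the whole space, $r$-packing if these spheres are pairwise disjoint, and $r$-perfect if both. The covering radius of $C$ is the smallest integer $r$ such that $C$ is $r$-covering. Induced weighted poset: write $u\sim v$ if $u=v$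 or there are directed paths from $u$ to $v$ and from $v$ to $u$; $\bar v$ is the class of $v$. Set $\bar u\preceq\bar v$ if $\bar u=\bar v$ or there is a path from some $a\in\bar v$ to some $b\in\bar u$. $P_{\tilde\pi}$ is $(V(G)/{\sim},\preceq)$ with weights $\tilde\pi(\bar v)=|\bar v|$. Let its elements be $\bar1,\dots,\bar m$; for $x\in\mathbb{F}_2^n$ let $X_{\bar i}$ be the restriction of $x$ to $\bar i$. Then $x^{\varphi_{\tilde\pi}}=(x_{\bar1},\dots,x_{\bar m})\in\mathbb{F}_2^m$ with $x_{\bar i}=0$ if $X_{\bar i}=0$ and $x_{\bar i}=1$ otherwise. $\widetilde{\mathcal H}_k\subseteq\mathbb{F}_2^{2^k}$ is the extended Hamming code: the null space of the $(k+1)\times2^k$ binary matrix whose first row is all ones and whose remaining $k$ rows form the matrix whose $i$-th column is the binary representation of $i-1$. *)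

(* Defs.v *)
From HB Require Import structures.
From mathcomp Require Import all_boot all_order all_algebra.

Set Implicit Arguments.
Unset Strict Implicit.
Unset Printing Implicit Defensive.

Import Order.TTheory GRing.Theory.

(* Binary vectors with coordinates labelled by a finite type. *)
Notation bvec T := {ffun T -> 'F_2}.

Definition supp (T : finType) (x : bvec T) : {set T} :=
  [set i | x i != 0%R].

Section Codes.

Variables (X : finType) (dist : X -> X -> nat).

Definition sphere (x : X) (r : nat) : {set X} := [set y | dist x y <= r].

Definition covering (C : {set X}) (r : nat) : Prop :=
  \bigcup_(c in C) sphere c r = [set: X].

Definition packing (C : {set X}) (r : nat) : Prop :=
  forall c c', c \in C -> c' \in C -> c != c' ->
    [disjoint sphere c r & sphere c' r].

Definition perfect (C : {set X}) (r : nat) : Prop :=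
  covering C r /\ packing C r.

Definition has_covering_radius (C : {set X}) (r : nat) : Prop :=
  covering C r /\ forall s, covering C s -> r <= s.

End Codes.

Section WeightedPoset.

Variables (d : Order.disp_t) (P : finPOrderType d).

Record weighting := Weighting {
  wt :> P -> nat;
  wt_gt0 : forall i, 0 < wt i
}.

Definition order_ideal (I : {set P}) : bool :=
  [forall i in I, forall j, (j <= i)%O ==> (j \in I)].

(* The intersection of all order ideals containing the support of x is the
   smallest one, as order ideals are closed under intersection. *)
Definition ideal_of (x : bvec P) : {set P} :=
  \bigcap_(I : {set P} | order_ideal I && (supp x \subset I)) I.

Variable pi : weighting.

Definition poset_weight (x : bvec P) : nat := \sum_(i in ideal_of x) pi i.

Definition poset_dist (x y : bvec P) : nat := poset_weight (x - y)%R.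

End WeightedPoset.

(* Multiple edges are excluded by encoding the edges as a relation. *)
Record digraph (V : finType) := Digraph {
  edge :> rel V;
  edge_irr : irreflexive edge
}.

Section DigraphMetric.

Variables (V : finType) (G : digraph V).

(* connect is reflexive, so this contains supp x. *)
Definition reach_of (x : bvec V) : {set V} :=
  [set v | [exists u in supp x, connect G u v]].

Definition digraph_weight (x : bvec V) : nat := #|reach_of x|.

Definition digraph_dist (x y : bvec V) : nat := digraph_weight (x - y)%R.

End DigraphMetric.

Section InducedPoset.

Variables (V : finType) (G : digraph V).

(* Reflexivity of connect accounts for the case u = v. *)
Definition mutual : rel V := fun u v => connect G u v && connect G v u.

Record scc := Scc {
  scc_set :> {set V};
  _ : scc_set \in equivalence_partition mutual [set: V]
}.

HB.instance Definition _ := [isSub for scc_set].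
HB.instance Definition _ := [Finite of scc by <:].

Lemma mutual_equiv : {in [set: V] & &, equivalence_rel mutual}.
Proof.
move=> u v w _ _ _; split; first by rewrite /mutual connect0.
case/andP=> uv vu; rewrite /mutual; congr (_ && _); apply/idP/idP.
- exact: connect_trans.
- exact: connect_trans.
- by move/connect_trans; apply.
- by move/connect_trans; apply.
Qed.

Lemma scc_neq0 (A : scc) : scc_set A != set0.
Proof.
case: A => A hA /=; case/and3P: (equivalence_partitionP mutual_equiv) => _ _.
by apply: contraNneq => <-.
Qed.

Lemma scc_connect (A : scc) u v : u \in scc_set A -> v \in scc_set A ->
  connect G u v.
Proof.
case: A => A /= /imsetP[w _ ->]; rewrite !inE /= => /andP[_ wu] /andP[wv _].
exact: connect_trans wu wv.
Qed.

Lemma scc_eq (A B : scc) u v : u \in scc_set A -> v \in scc_set B ->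
  connect G u v -> connect G v u -> A = B.
Proof.
move=> uA vB uv vu; apply: val_inj => /=; move: uA vB.
case: A B => [A /= /imsetP[a _ ->]] [B /= /imsetP[b _ ->]].
rewrite !inE /= => /andP[au ua] /andP[bv vb]; apply/setP=> w; rewrite !inE /=.
have ab : connect G a b by apply: (connect_trans au); apply: (connect_trans uv).
have ba : connect G b a by apply: (connect_trans bv); apply: (connect_trans vu).
by apply/andP/andP => -[p q]; split;
  by [apply: connect_trans p | apply: connect_trans q _].
Qed.

(* A is below B when it can be reached from B. *)
Definition scc_le (A B : scc) : bool :=
  (A == B) || [exists b in scc_set B, exists a in scc_set A, connect G b a].

Lemma scc_leP (A B : scc) a b : a \in scc_set A -> b \in scc_set B ->
  scc_le A B = connect G b a.
Proof.
move=> aA bB; apply/orP/idP => [[/eqP eAB|]|ba].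
- by rewrite eAB in aA; apply: scc_connect bB aA.
- case/exists_inP=> b' b'B /exists_inP[a' a'A b'a'].
  apply: connect_trans (scc_connect bB b'B) _.
  exact: connect_trans b'a' (scc_connect a'A aA).
- by right; apply/exists_inP; exists b => //; apply/exists_inP; exists a.
Qed.

Lemma scc_le_refl : reflexive scc_le.
Proof. by move=> A; rewrite /scc_le eqxx. Qed.

Lemma scc_le_anti : antisymmetric scc_le.
Proof.
move=> A B; have [[a aA] [b bB]] := (set0Pn _ (scc_neq0 A), set0Pn _ (scc_neq0 B)).
by rewrite (scc_leP aA bB) (scc_leP bB aA) => /andP[ba ab]; apply: scc_eq aA bB ab ba.
Qed.

Lemma scc_le_trans : transitive scc_le.
Proof.
move=> B A C; have [b bB] := set0Pn _ (scc_neq0 B).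
have [[a aA] [c cC]] := (set0Pn _ (scc_neq0 A), set0Pn _ (scc_neq0 C)).
rewrite (scc_leP aA bB) (scc_leP bB cC) (scc_leP aA cC) => ba cb.
exact: connect_trans cb ba.
Qed.

Fact scc_display : Order.disp_t. Proof. exact: Order.Disp tt tt. Qed.

HB.instance Definition _ := Order.Le_isPOrder.Build scc_display scc
  scc_le_refl scc_le_anti scc_le_trans.

Lemma scc_card_gt0 (A : scc) : 0 < #|scc_set A|.
Proof. by rewrite card_gt0 scc_neq0. Qed.

Definition scc_weighting : weighting scc := Weighting scc_card_gt0.

Definition induced_map (x : bvec V) : bvec scc :=
  [ffun A : scc => if [forall v in scc_set A, x v == 0%R] then 0%R else 1%R].

End InducedPoset.

(* Coordinate i of 1, ..., 2 ^ k is the ordinal i - 1, so column j holds the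
   binary representation of j, most significant bit on top. *)
Definition ext_hamming_check (k : nat) : 'M['F_2]_(1 + k, 2 ^ k) :=
  col_mx (const_mx 1%R)
    (\matrix_(i < k, j < 2 ^ k) (odd (j %/ 2 ^ (k - i.+1)) : nat)%:R%R).

Definition ext_hamming (k : nat) : {set bvec 'I_(2 ^ k)} :=
  [set x : bvec 'I_(2 ^ k) | (ext_hamming_check k *m \col_j x j == 0)%R].

(* Main.v *)
Require Import Defs.
From mathcomp Require Import all_boot all_order all_algebra.

(** The covering half is soft.  A binary vector [z] on the strong components is
    the image of a vector [y] on the vertices; a codeword [c] at digraph
    distance at most 2 from [y] has an image at poset distance at most 2 from
    [z], because a reachable set is a union of strong components and a
    component is weighted by its size ([poset_dist_induced_le]).

    What has to be shown is that radius 1 does not suffice, and this holds for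
    any binary code [C] that is closed under subtraction, has only even weights
    and has minimum distance 4, as soon as [C] is 2-covering for the digraph
    metric on at least three vertices.

    The key is that at least two vertices [u], [v] are strong components by
    themselves ([two_trivial_scc]).  Fix a vertex [o].  For each [w != o] the
    vector with support [{o, w}] differs from some codeword by a vector [x w]
    whose reachable set has size at most 2; by parity and minimum distance the
    support of [x w] has size exactly 2, hence equals its reachable set.  These
    [n - 1] closed pairs cannot be disjoint among [n > 2] vertices, and they are
    distinct since a shared one would give a codeword supported in
    [{o, w1, w2}].  Two distinct closed pairs that meet in [u] make [u] a sink,
    so the other element [v] of the first pair has no way back from [u].

    The image of the vector [p] with support [{u, v}] then lies at poset
    distance at least 2 from the image of every codeword [c].  Otherwise the two
    images differ in components covering at most one vertex in total, and
    outside these [c] vanishes off [{u, v}]; so [c] has weight at most 3, hence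
    is 0, and the image of [p] itself has weight at least 2.

    The extended Hamming code satisfies the hypotheses: its all-ones row gives
    even weights, and its columns are distinct because a number below [2 ^ k] is
    determined by its [k] binary digits. *)

Set Implicit Arguments.
Unset Strict Implicit.
Unset Printing Implicit Defensive.

Import GRing.Theory.

(** * Supports of binary vectors *)

Section BinaryVectors.

Variable T : finType.
Implicit Types (x y : bvec T) (A : {set T}).

Definition indic A : bvec T := [ffun i => (i \in A)%:R%R].

Lemma F2_neq0 (a : 'F_2) : (a != 0%R) = (a == 1%R).
Proof. by case: a => [[|[|]]]. Qed.

Lemma supp_indic A : supp (indic A) = A.
Proof. by apply/setP=> i; rewrite inE ffunE; case: (i \in A). Qed.

Lemma supp_inj : injective (@supp T).
Proof.
move=> x y /setP e; apply/ffunP=> i; have := e i; rewrite !inE !F2_neq0.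
by case: (x i) (y i) => [[|[|]]//?] [[|[|]]//?] // _; apply: val_inj.
Qed.

Lemma supp0 : supp (0%R : bvec T) = set0.
Proof. by apply/setP=> i; rewrite !inE ffunE eqxx. Qed.

Lemma supp_opp x : supp (- x)%R = supp x.
Proof. by apply/setP=> i; rewrite !inE ffunE oppr_eq0. Qed.

Lemma supp_subP x y i : i \in supp (x - y)%R -> i \in supp x :|: supp y.
Proof.
rewrite !inE !ffunE; apply: contraNT; rewrite negb_or !negbK.
by case/andP=> /eqP-> /eqP->; rewrite subr0.
Qed.

Lemma sum_supp x : (\sum_i x i = #|supp x|%:R)%R.
Proof.
rewrite (bigID (mem (supp x))) /= [X in (_ + X)%R]big1 => [|i]; last first.
  by rewrite inE negbK => /eqP.
rewrite addr0 -sumr_const; apply: eq_bigr => i.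
by rewrite inE F2_neq0 => /eqP.
Qed.

Lemma odd_natrF2 n : odd n = (n%:R != 0 :> 'F_2)%R.
Proof.
by elim: n => // n IHn; rewrite mulrS /= IHn; case: (n%:R)%R => [[|[|]]].
Qed.

Lemma odd_supp_sub x y : odd #|supp (x - y)%R| = odd #|supp x| (+) odd #|supp y|.
Proof.
rewrite !odd_natrF2 -!sum_supp.
have -> : (\sum_i (x - y) i = \sum_i x i - \sum_i y i)%R.
  by rewrite -sumrB; apply: eq_bigr => i _; rewrite !ffunE.
by move: (\sum_i x i)%R (\sum_i y i)%R => [[|[|]]//?] [[|[|]]//?].
Qed.

End BinaryVectors.

(** * Closed pairs and strong components *)

(** Disjoint pairs indexed by all but one of the [n] points would occupy
    [2 * (n - 1)] points, more than the [n] available once [n > 2]. *)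
Lemma exists_meeting_pairs (T : finType) (o : T) (F : T -> {set T}) :
  2 < #|T| -> (forall w, w != o -> #|F w| = 2) ->
  exists w1 w2, [/\ w1 != o, w2 != o, w1 != w2 & F w1 :&: F w2 != set0].
Proof.
move=> T_gt2 F2.
case: (boolP [exists p : T * T, [&& p.1 != o, p.2 != o, p.1 != p.2
   & F p.1 :&: F p.2 != set0]]) => [/existsP[[w1 w2] /and4P[]]|nopair].
  by exists w1, w2; split.
(* If no two pairs meet, each point is counted in at most one of them. *)
have: \sum_(w | w != o) #|F w| <= #|T|.
  under eq_bigr do rewrite -sum1_card.
  rewrite (exchange_big_dep predT) //= -sum1_card.
  apply: leq_sum => v _; rewrite sum1_card.
  apply/card_le1_eqP => w1 w2; rewrite !unfold_in => /andP[w1o vw1] /andP[w2o vw2].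
  apply/eqP; apply: contraNT nopair => w12; apply/existsP; exists (w2, w1) => /=.
  by rewrite w1o w2o w12 /=; apply/set0Pn; exists v; rewrite inE; apply/andP; split.
rewrite (eq_bigr (fun=> 2)) // sum_nat_const (eq_card (_ : _ =i predC1 o)) //.
rewrite cardC1; case: #|T| T_gt2 => [|[|[|n]]] //= _.
by rewrite !mulSn !add2n !ltnS muln2 -addnn ltnNge leq_addr.
Qed.

Section Components.

Variables (V : finType) (G : digraph V).
Implicit Types (x y : bvec V) (A : scc G).

Definition scc_of v : scc G :=
  Scc (imset_f (fun u => [set w in [set: V] | mutual G u w]) (in_setT v)).

Lemma mem_scc_of v w : (w \in scc_set (scc_of v)) = mutual G v w.
Proof. by rewrite !inE. Qed.

Lemma scc_of_id v : v \in scc_set (scc_of v).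
Proof. by rewrite mem_scc_of /mutual connect0. Qed.

Lemma mem_scc v A : (v \in scc_set A) = (scc_of v == A).
Proof.
apply/idP/eqP => [vA|<-]; last exact: scc_of_id.
exact: scc_eq (scc_of_id v) vA (connect0 _ _) (connect0 _ _).
Qed.

(** The strong components partition the vertices, so poset weights are
    cardinals of sets of vertices. *)
Lemma sum_card_scc (I : {set scc G}) :
  \sum_(A in I) #|scc_set A| = #|[set v | scc_of v \in I]|.
Proof.
rewrite -sum1_card (partition_big scc_of (mem I)) => [|v]; last by rewrite inE.
apply: eq_bigr => A AI; rewrite -sum1_card; apply: eq_bigl => v.
by rewrite inE mem_scc; case: eqP => [->|]; rewrite ?AI ?andbF.
Qed.

Lemma mem_supp_induced x A :
  (A \in supp (induced_map G x)) = [exists v in scc_set A, v \in supp x].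
Proof.
rewrite inE ffunE -[RHS]negbK negb_exists_in.
under [in RHS]eq_forallb => v do rewrite inE negbK.
by case: [forall _ in _, _]; rewrite ?eqxx.
Qed.

Lemma supp_induced_sub x y :
  supp (induced_map G x - induced_map G y)%R \subset supp (induced_map G (x - y)%R).
Proof.
apply/subsetP=> A; rewrite mem_supp_induced; apply: contraTT => /exists_inPn no.
have eqxy v : v \in scc_set A -> x v = y v.
  by move/no; rewrite inE negbK !ffunE subr_eq0 => /eqP.
rewrite inE negbK !ffunE subr_eq0; apply/eqP; congr (if _ then _ else _).
by apply: eq_forallb_in => v /eqxy->.
Qed.

Lemma induced_map_surj (z : bvec (scc G)) : exists x, induced_map G x = z.
Proof.
exists (indic [set v | scc_of v \in supp z]); apply: supp_inj; apply/setP=> A.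
rewrite mem_supp_induced supp_indic; apply/exists_inP/idP => [[v]|Az].
  by rewrite mem_scc => /eqP<-; rewrite inE.
have [v vA] := set0Pn _ (scc_neq0 A); exists v => //.
by move: vA; rewrite mem_scc inE => /eqP->.
Qed.

(** The components contained in the vertices reachable from [x - y] form an
    order ideal that contains every component on which [x] and [y] differ. *)
Lemma poset_dist_induced_le x y :
  poset_dist (scc_weighting G) (induced_map G x) (induced_map G y)
    <= digraph_dist G x y.
Proof.
set R := reach_of G (x - y)%R.
(* R is saturated: it contains a component as soon as it meets it. *)
have memR A v : v \in scc_set A -> (scc_set A \subset R) = (v \in R).
  move=> vA; apply/subsetP/idP => [/(_ v vA)//|].
  rewrite inE => /exists_inP[u ux uv] w wA; rewrite inE.
  by apply/exists_inP; exists u => //; apply: connect_trans uv (scc_connect vA wA).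
pose I := [set A : scc G | scc_set A \subset R].
have idealI : order_ideal I.
  apply/forall_inP=> A AI; apply/forallP=> B; apply/implyP=> leBA.
  have [[a aA] [b bB]] := (set0Pn _ (scc_neq0 A), set0Pn _ (scc_neq0 B)).
  move: AI; rewrite !inE (memR _ _ aA) (memR _ _ bB) !inE => /exists_inP[u ux ua].
  apply/exists_inP; exists u => //; apply: connect_trans ua _.
  by rewrite -(scc_leP bB aA).
have suppI : supp (induced_map G x - induced_map G y)%R \subset I.
  apply: subset_trans (supp_induced_sub x y) _; apply/subsetP=> A.
  rewrite mem_supp_induced => /exists_inP[v vA vx]; rewrite inE (memR _ _ vA) inE.
  by apply/exists_inP; exists v.
have idI : ideal_of (induced_map G x - induced_map G y)%R \subset I.
  by apply: bigcap_inf; rewrite idealI.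
rewrite /poset_dist /poset_weight /= sum_card_scc subset_leq_card //.
apply/subsetP=> v; rewrite inE => /(subsetP idI).
by rewrite inE (memR _ _ (scc_of_id v)).
Qed.

Lemma card_supp_le_poset_weight (z : bvec (scc G)) :
  #|[set v | scc_of v \in supp z]| <= poset_weight (scc_weighting G) z.
Proof.
rewrite /poset_weight /= sum_card_scc subset_leq_card //.
apply/subsetP=> v; rewrite !inE -(in_set (fun A => z A != 0%R)) => vz.
by apply/bigcapP=> I /andP[_ /subsetP]; apply.
Qed.

Lemma covering_induced (C : {set bvec V}) r :
  covering (digraph_dist G) C r ->
  covering (poset_dist (scc_weighting G)) (induced_map G @: C) r.
Proof.
move=> cov; apply/setP=> z; rewrite in_setT.
have [x <-] := induced_map_surj z.
have: x \in \bigcup_(c in C) sphere (digraph_dist G) c r by rewrite cov in_setT.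
case/bigcupP=> c cC; rewrite inE => dcx.
apply/bigcupP; exists (induced_map G c); first exact: imset_f.
by rewrite inE (leq_trans (poset_dist_induced_le _ _)).
Qed.

(** * Even codes of minimum distance 4 *)

Section EvenDistance4.

Variable C : {set bvec V}.
Hypothesis C_sub : {in C &, forall x y, (x - y)%R \in C}.
Hypothesis C_even : {in C, forall x, ~~ odd #|supp x|}.
Hypothesis C_dist4 : {in C, forall x, #|supp x| <= 3 -> x = 0%R}.

Definition trivial_scc v := forall w, mutual G v w -> w = v.

(** Covering by spheres of radius 2 forces many pairs of vertices to be closed
    under reachability, and two distinct such pairs with a common vertex consist
    of vertices that lie on no directed cycle. *)
Lemma two_trivial_scc : 2 < #|V| -> covering (digraph_dist G) C 2 ->
  exists u v, [/\ u != v, trivial_scc u & trivial_scc v].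
Proof.
move=> V_gt2 cov.
have [o _] : exists o : V, o \in V by apply/card_gt0P; apply: leq_trans V_gt2.
have near w : exists x, w != o ->
    [/\ (indic [set o; w] + x)%R \in C, #|supp x| = 2 & reach_of G x = supp x].
  have: indic [set o; w] \in \bigcup_(c in C) sphere (digraph_dist G) c 2.
    by rewrite cov in_setT.
  case/bigcupP=> c cC; rewrite inE => le2.
  (* c equals the vector on {o, w} plus the witness. *)
  exists (c - indic [set o; w])%R => wo.
  set x := (c - _)%R in le2 *.
  have sub_reach : supp x \subset reach_of G x.
    by apply/subsetP=> v vx; rewrite inE; apply/exists_inP; exists v.
  have card_pair : #|supp (indic [set o; w])| = 2.
    by rewrite supp_indic cards2 eq_sym wo.
  have x_even : ~~ odd #|supp x|.
    by rewrite odd_supp_sub card_pair /= addbF C_even.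
  have x_le2 : #|supp x| <= 2 := leq_trans (subset_leq_card sub_reach) le2.
  have x_neq0 : #|supp x| != 0.
    apply/eqP=> /cards0_eq; rewrite -supp0 => /supp_inj/subr0_eq ec.
    have c0 : c = 0%R by apply: C_dist4 => //; rewrite ec card_pair.
    by move: card_pair; rewrite -ec c0 supp0 cards0.
  have x2 : #|supp x| = 2 by move: x_even x_le2 x_neq0; case: #|_| => [|[|[|]]].
  split=> //; last by apply/esym/eqP; rewrite eqEcard sub_reach x2.
  by rewrite /x addrC subrK.
have [x xP] := fin_all_exists near.
have x2 w : w != o -> #|supp (x w)| = 2 by case/xP.
have [w1 [w2 [w1o w2o w12 /set0Pn[u]]]] := exists_meeting_pairs V_gt2 x2.
rewrite inE => /andP[u1 u2].
have [[C1 card1 reach1] [C2 card2 reach2]] := (xP _ w1o, xP _ w2o).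
have closed w : reach_of G (x w) = supp (x w) -> forall a b, a \in supp (x w) ->
    connect G a b -> b \in supp (x w).
  by move=> <- a b; rewrite !inE => /exists_inP[c cx ca] ab;
     apply/exists_inP; exists c => //; apply: connect_trans ab.
have x12 : supp (x w1) != supp (x w2).
  apply: contraNneq w12 => /supp_inj x12.
  have dC := C_sub C1 C2; set d := (_ - _)%R in dC.
  have dE : d = (indic [set o; w1] - indic [set o; w2])%R.
    by rewrite /d x12 opprD addrACA subrr addr0.
  have d0 : d = 0%R.
    have d_sub : supp d \subset [set o; w1; w2].
      apply/subsetP=> i; rewrite dE => /supp_subP; rewrite !supp_indic !inE.
      by do ![case: (_ == _)].
    apply: C_dist4 => //; apply: leq_trans (subset_leq_card d_sub) _.
    by rewrite -!setUA cardsU1 cards2; do ![case: (_ \notin _)|case: (_ == _)].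
  have := congr1 (fun f : bvec V => f w1) dE; rewrite d0 !ffunE !inE eqxx orbT.
  by rewrite (negPf w1o) /=; case: eqP.
(* Two distinct pairs share at most one point, and the intersection is closed. *)
have inter_u a : a \in supp (x w1) -> a \in supp (x w2) -> a = u.
  move=> a1 a2; apply/eqP; apply: contraNT x12 => au.
  have sub w : #|supp (x w)| = 2 -> u \in supp (x w) -> a \in supp (x w) ->
      supp (x w) = [set a; u].
    move=> cw uw aw; apply/esym/eqP; rewrite eqEcard cw cards2 au andbT.
    by apply/subsetP=> b; rewrite in_set2 => /orP[] /eqP->.
  by rewrite (sub _ card1 u1 a1) (sub _ card2 u2 a2).
have u_sink b : connect G u b -> b = u.
  by move=> ub; apply: inter_u; apply: closed ub.
have [v] : exists v, v \in supp (x w1) :\ u.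
  by apply/card_gt0P; move: card1; rewrite (cardsD1 u) u1 add1n => -[->].
rewrite in_setD1 => /andP[vu v1]; exists u, v; split; first by rewrite eq_sym.
  by move=> b /andP[/u_sink].
(* A third vertex b of the component of v would enlarge the closed pair, and u
   cannot lead back to v. *)
move=> b /andP[vb bv]; have b1 := closed _ reach1 _ _ v1 vb.
apply/eqP; apply: contra_eqT card1 => bv'.
have bu : b != u by apply: contraNneq vu => bu; rewrite -(u_sink v) -?bu // bu.
rewrite (cardsD1 u) u1 (cardsD1 v) in_setD1 vu v1 (cardsD1 b).
by rewrite !in_setD1 bv' bu b1.
Qed.

(** At distance less than 2 from the image of the pair given by
    [two_trivial_scc], only the image of the zero codeword is possible, and it
    is too far away. *)
Lemma not_covering_induced1 r : r < 2 -> 2 < #|V| ->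
  covering (digraph_dist G) C 2 ->
  ~ covering (poset_dist (scc_weighting G)) (induced_map G @: C) r.
Proof.
move=> r_lt2 V_gt2 /(two_trivial_scc V_gt2)[u [v [uv trivu trivv]]] cov.
set p := indic [set u; v].
have: induced_map G p \in [set: bvec (scc G)] by rewrite in_setT.
rewrite -cov => /bigcupP[_ /imsetP[c cC ->]]; rewrite inE /poset_dist.
set z := (_ - _)%R => wz.
set Z := [set w | scc_of w \in supp z].
have Z1 : #|Z| <= 1.
  apply: leq_trans (card_supp_le_poset_weight z) _.
  by rewrite -ltnS (leq_ltn_trans wz).
(* Away from Z the images agree, and there a component that meets {u, v} has no
   other vertex. *)
have c_sub : supp c \subset Z :|: [set u; v].
  apply/subsetP=> w wc; rewrite !inE orbC; apply/orP.
  case: (boolP (scc_of w \in supp z)) => [|wz0]; [by rewrite inE; right|left].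
  have: scc_of w \in supp (induced_map G c).
    by rewrite mem_supp_induced; apply/exists_inP; exists w => //; apply: scc_of_id.
  have -> : (scc_of w \in supp (induced_map G c)) =
      (scc_of w \in supp (induced_map G p)).
    move: wz0; rewrite [_ \in supp z]inE negbK ffunE [X in (_ + X)%R]ffunE.
    by rewrite subr_eq0 !inE => /eqP->.
  rewrite mem_supp_induced supp_indic => /exists_inP[t].
  rewrite mem_scc_of /mutual andbC !inE => tw /orP[] /eqP et; subst t.
    by rewrite (trivu w tw) eqxx.
  by rewrite (trivv w tw) eqxx orbT.
have c0 : c = 0%R.
  apply: C_dist4 => //; apply: leq_trans (subset_leq_card c_sub) _.
  apply: leq_trans (leq_card_setU _ _) _.
  by rewrite cards2 uv addn2 !ltnS.
have p_sub : [set u; v] \subset Z.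
  apply/subsetP=> w wp; rewrite inE.
  have -> : z = (- induced_map G p)%R.
    rewrite /z; suff -> : induced_map G c = 0%R by rewrite sub0r.
    apply: supp_inj; apply/setP=> A; rewrite mem_supp_induced c0 !supp0 inE.
    by apply/exists_inP=> -[t _]; rewrite inE.
  rewrite supp_opp mem_supp_induced supp_indic.
  by apply/exists_inP; exists w => //; apply: scc_of_id.
by have := leq_trans (subset_leq_card p_sub) Z1; rewrite cards2 uv.
Qed.

Lemma induced_covering_radius2 : 2 < #|V| ->
  covering (digraph_dist G) C 2 ->
  has_covering_radius (poset_dist (scc_weighting G)) (induced_map G @: C) 2.
Proof.
move=> V_gt2 cov; split; first exact: covering_induced.
by move=> s covs; rewrite leqNgt; apply/negP=> /not_covering_induced1; apply.
Qed.

End EvenDistance4.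

End Components.

(** * The extended Hamming code *)

Section ExtendedHamming.

Variable k : nat.

Lemma eq_bits m i j : i < 2 ^ m -> j < 2 ^ m ->
  (forall a, a < m -> odd (i %/ 2 ^ a) = odd (j %/ 2 ^ a)) -> i = j.
Proof.
elim: m i j => [|m IHm] i j; first by rewrite expn0 !ltnS !leqn0 => /eqP-> /eqP->.
rewrite expnS => im jm bits.
have half : i %/ 2 = j %/ 2.
  apply: IHm => [||a am]; rewrite ?ltn_divLR // 1?mulnC //.
  by rewrite -!divnMA -expnS bits.
have := bits 0 isT; rewrite expn0 !divn1 => o.
by rewrite (divn_eq i 2) (divn_eq j 2) half !modn2 o.
Qed.

(** The row index of the check matrix counts digits from the most significant
    one; here [a] counts them from the least significant one. *)
Lemma ext_hammingP (x : bvec 'I_(2 ^ k)) :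
  reflect ((\sum_j x j = 0)%R /\
    forall a, a < k ->
      (\sum_(j < 2 ^ k) (odd (j %/ 2 ^ a) : nat)%:R * x j = 0)%R)
    (x \in ext_hamming k).
Proof.
rewrite inE mul_col_mx col_mx_eq0.
apply: (iffP andP) => [[/eqP/matrixP h1 /eqP/matrixP h2]|[h1 h2]].
  split=> [|a ak].
    have := h1 ord0 ord0; rewrite !mxE => e; rewrite -[RHS]e.
    by apply: eq_bigr => j _; rewrite !mxE mul1r.
  have lt : k - a.+1 < k by rewrite ltn_subrL (leq_trans _ ak).
  have := h2 (Ordinal lt) ord0; rewrite !mxE => e; rewrite -[RHS]e.
  by apply: eq_bigr => j _; rewrite !mxE /= subnSK // subKn // ltnW.
split; apply/eqP/matrixP=> i l; rewrite !mxE.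
  by rewrite -[RHS]h1; apply: eq_bigr => j _; rewrite !mxE mul1r.
have lt : k - i.+1 < k by rewrite ltn_subrL (leq_trans _ (ltn_ord i)).
by rewrite -[RHS](h2 _ lt); apply: eq_bigr => j _; rewrite !mxE.
Qed.

Lemma ext_hamming_sub :
  {in ext_hamming k &, forall x y, (x - y)%R \in ext_hamming k}.
Proof.
move=> x y /ext_hammingP[x1 x2] /ext_hammingP[y1 y2]; apply/ext_hammingP; split.
  under eq_bigr do rewrite ffunE [X in (_ + X)%R]ffunE.
  by rewrite sumrB x1 y1 subrr.
move=> a ak; under eq_bigr do rewrite ffunE [X in (_ + X)%R]ffunE mulrBr.
by rewrite sumrB x2 // y2 // subrr.
Qed.

Lemma ext_hamming_even : {in ext_hamming k, forall x, ~~ odd #|supp x|}.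
Proof.
by move=> x /ext_hammingP[x1 _]; rewrite odd_natrF2 -sum_supp x1 eqxx.
Qed.

(** Even weights leave only weight 2 to exclude: it would make two columns of
    the check matrix equal. *)
Lemma ext_hamming_dist4 :
  {in ext_hamming k, forall x, #|supp x| <= 3 -> x = 0%R}.
Proof.
move=> x xC x_le3; have x_even := ext_hamming_even xC.
have x_neq2 : #|supp x| != 2.
  apply/negP=> /cards2P[i [j [ij supp_x]]].
  have [_ x2] := ext_hammingP _ xC.
  have x_indic : x = indic [set i; j] by apply: supp_inj; rewrite supp_indic.
  apply: (negP ij); apply/eqP/val_inj/(eq_bits (ltn_ord i) (ltn_ord j)) => a ak.
  move: (x2 a ak); rewrite (bigD1 i) //= (bigD1 j) 1?eq_sym ?ij //= big1 => [|l].
    rewrite x_indic !ffunE !inE !eqxx orbT !mulr1 addr0.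
    by case: (odd _) (odd _) => [] [].
  by case/andP=> li lj; rewrite x_indic ffunE !inE (negPf li) (negPf lj) mulr0.
apply: supp_inj; rewrite supp0; apply/eqP; rewrite -cards_eq0.
by move: x_le3 x_even x_neq2; case: #|supp x| => [|[|[|[|]]]].
Qed.

End ExtendedHamming.

Theorem theorem3p15 (k : nat) (hk : 2 <= k) (G : digraph 'I_(2 ^ k)) :
  perfect (digraph_dist G) (ext_hamming k) 2 ->
  has_covering_radius (poset_dist (scc_weighting G))
    (induced_map G @: ext_hamming k) 2.
Proof.
case=> cov _; apply: induced_covering_radius2 cov.
- exact: ext_hamming_sub.
- exact: ext_hamming_even.
- exact: ext_hamming_dist4.
- by rewrite card_ord (leq_trans _ (leq_pexp2l _ hk)).
Qed.
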